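(* Let $R$ be a ring. Then the right $R$-module $R$ is a dual $\pi$-Rickart module if and only if $R$ is a $\pi$-regular ring.
   Context: Rings are associative with identity (not necessarily commutative) and modules are unitary right modules. For a right $R$-module $M$ with $S=\mathrm{End}_R(M)$, $M$ is called dual $\pi$-Rickart if for every $f\in S$ there exist $e^2=e\in S$ and a positive integer $n$ such that $\mathrm{Im} f^n=eM$. A ring $R$ is $\pi$-regular if for each $a\in R$ there exist a positive integer $n$ and an element $x\in R$ such that $a^n=a^nxa^n$. *)

(* Defs.v *)
From HB Require Import structures.
From mathcomp Require Import all_boot all_algebra classical_sets.

Set Implicit Arguments.
Unset Strict Implicit.
Unset Printing Implicit Defensive.

Import GRing.Theory.
Local Open Scope ring_scope.

(* Rings are [pzRingType]: associative, unital, with the zero ring allowed.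
   A right R-module is a left module over the converse ring, i.e. an
   [lmodType R^c], the right action of r on x being [r *: x]. *)

(* Elements of End_R(M) are the linear maps [{linear M -> M}], multiplied by
   composition, so the n-th power of f is [iter n f], and eM is [range e]. *)
Definition dual_pi_rickart (R : pzRingType) (M : lmodType R^c) : Prop :=
  forall f : {linear M -> M}, exists (e : {linear M -> M}) (n : nat),
    [/\ idempotent_fun e, (0 < n)%N & range (iter n f) = range e].

Definition pi_regular (R : pzRingType) : Prop :=
  forall a : R, exists (n : nat) (x : R),
    (0 < n)%N /\ a ^+ n = a ^+ n * x * a ^+ n.

(* R as a right module over itself: [R^c] acts on the regular module [(R^c)^o]
   by left multiplication in [R^c], which is right multiplication in R. *)
Definition right_regular (R : pzRingType) : lmodType R^c := (R^c)^o.

Lemma right_regularE (R : pzRingType) (r x : R) :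
  (r : R^c) *: (x : right_regular R) = x * r :> R.
Proof. by []. Qed.

(* Main.v *)
Require Import Defs.
From HB Require Import structures.
From mathcomp Require Import all_boot all_algebra.
From mathcomp Require Import classical_sets.

(** Endomorphisms of R as a right module over itself are left multiplications,
    so Im f^n = a^n R with a = f 1. If a^n R = cR with c idempotent, then c is
    some a^n x and fixes a^n, whence a^n = a^n x a^n. Conversely, if
    a^n = a^n x a^n, then c = a^n x is idempotent and a^n R = cR. *)

Import GRing.Theory.
Local Open Scope ring_scope.

Definition left_mul {R : pzRingType} (a : R) :
  right_regular R -> right_regular R := fun x => a * (x : R).

Lemma left_mul_is_linear {R : pzRingType} (a : R) : linear (left_mul a).
Proof.
move=> r x y; rewrite /left_mul.
(* The scalar action is right multiplication up to conversion. *)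
transitivity (a * ((x : R) * (r : R) + (y : R))); first by [].
by rewrite mulrDr mulrA.
Qed.

HB.instance Definition _ (R : pzRingType) (a : R) :=
  GRing.isLinear.Build R^c (right_regular R) (right_regular R) _ (left_mul a)
    (left_mul_is_linear a).

(** Since [x] is [1] acted on by [x], linearity pulls the scalar [x] out of [f]. *)
Lemma linear_right_regularE {R : pzRingType}
    (f : {linear right_regular R -> right_regular R}) (x : R) :
  f x = (f (1 : R) : R) * x :> R.
Proof.
have := linearZ_LR f (x : R^c) (1 : R).
by rewrite !right_regularE mul1r.
Qed.

Lemma iter_linear_right_regularE {R : pzRingType}
    (f : {linear right_regular R -> right_regular R}) (n : nat) (x : R) :
  iter n f x = (f (1 : R) : R) ^+ n * x :> R.
Proof.
elim: n => [|n IHn]; first by rewrite expr0 mul1r.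
by rewrite iterS linear_right_regularE IHn exprS mulrA.
Qed.

Theorem proposition2p2 (R : pzRingType) :
  dual_pi_rickart (right_regular R) <-> pi_regular R.
Proof.
split=> [rickR a | regR f].
- have [e [n [e_idem n_gt0 im_eq]]] := rickR (left_mul a).
  have iterE (x : R) : iter n (left_mul a) x = a ^+ n * x :> R.
    rewrite (iter_linear_right_regularE (left_mul a)).
    by congr (_ ^+ _ * _); exact: mulr1.
  (* As [e 1] generates the image of [e], its preimage under the [n]-th iterate is the [x]
     sought. *)
  have [x _ xE] : range (iter n (left_mul a)) (e (1 : R)).
    by rewrite im_eq; exists (1 : R).
  have [y _ yE] : range e (a ^+ n : R).
    by rewrite -im_eq; exists (1 : R) => //; rewrite iterE mulr1.
  exists n, x; split=> //.
  (* The goal becomes [e y = e (e y)], where [e y] is [a ^+ n]. *)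
  rewrite -iterE xE -linear_right_regularE -yE.
  exact/esym/e_idem.
- have [n [x [n_gt0 anE]]] := regR (f (1 : R)).
  set a : R := f (1 : R) in anE.
  exists (left_mul (a ^+ n * x)), n; split=> //.
    by move=> y; rewrite /= /left_mul mulrA (mulrA (_ * x)) -anE.
  apply/seteqP; split=> _ [y _ <-].
    (* Left multiplication by [a ^+ n * x] fixes [a ^+ n], so [a ^+ n * y] is its own preimage. *)
    exists (a ^+ n * (y : R) : R) => //.
    by rewrite iter_linear_right_regularE /= /left_mul mulrA -anE.
  by exists (x * (y : R) : R) => //; rewrite iter_linear_right_regularE mulrA.
Qed.
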